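(* Let $M$ be a finite simple graph on $p$ vertices and let $\Delta$ be the maximum vertex degree of $M$. Then the path energy of $M$ satisfies $PE(M) \leq p(p-1)\Delta$.
   Context: For a finite simple graph $M$ with vertex set $\{v_1,\dots,v_p\}$, the path matrix $P(M)=(p_{i,j})$ is the $p\times p$ real symmetric matrix with $p_{i,i}=0$ and, for $i\neq j$, $p_{i,j}$ equal to the maximum number of vertex disjoint paths from $v_i$ to $v_j$ (i.e. paths that pairwise share no vertices other than the endpoints $v_i,v_j$; an edge $v_iv_j$ counts as one such path). The path eigenvalues of $M$ are the eigenvalues of $P(M)$, and the path energy $PE(M)$ is the sum of the absolute values of the path eigenvalues, counted with multiplicity. *)

(* Defs.v *)
From mathcomp Require Import all_boot all_order all_algebra.
From mathcomp Require Import complex polyrcf.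

Set Implicit Arguments.
Unset Strict Implicit.
Unset Printing Implicit Defensive.

Import Order.TTheory GRing.Theory Num.Theory.
Local Open Scope ring_scope.

Record simple_graph (p : nat) := SimpleGraph {
  adj : rel 'I_p;
  adj_sym : symmetric adj;
  adj_irrefl : irreflexive adj }.

Section Graph.
Variables (p : nat) (M : simple_graph p).

Definition degree (i : 'I_p) : nat := #|[set j | adj M i j]|.

Definition max_degree : nat := \max_(i < p) degree i.

(* [s] lists all the vertices of the path, both endpoints included. *)
Definition is_path (i j : 'I_p) (s : seq 'I_p) : bool :=
  if s is x :: s' then [&& x == i, path (adj M) x s', last x s' == j & uniq s]
  else false.

(* The members of a family of paths are pairwise distinct because the family
   is a set; in particular the edge path [:: i; j] occurs at most once.  A path
   has no repeated vertex, so [p.-bseq 'I_p] contains all of them. *)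
Definition disjoint_paths (i j : 'I_p) (F : {set p.-bseq 'I_p}) : bool :=
  [forall s in F, is_path i j s] &&
  [forall s in F, forall t in F, (s != t) ==>
     [forall x, (x \in s) && (x \in t) ==> (x == i) || (x == j)]].

Definition max_disjoint_paths (i j : 'I_p) : nat :=
  \max_(F : {set p.-bseq 'I_p} | disjoint_paths i j F) #|F|.

Definition path_mx (R : pzRingType) : 'M[R]_p :=
  \matrix_(i, j) if i == j then 0 else (max_disjoint_paths i j)%:R.

End Graph.

(* Roots in [R] of the characteristic polynomial, repeated according to their
   algebraic multiplicity.  When [A] is symmetric these are all the eigenvalues
   of [A]: see [char_poly_real_eigenvalues] below. *)
Definition real_eigenvalues (R : rcfType) (n : nat) (A : 'M[R]_n) : seq R :=
  flatten [seq nseq (mup x (char_poly A)) x | x <- rootsR (char_poly A)].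

Definition path_eigenvalues (R : rcfType) (p : nat) (M : simple_graph p) :
  seq R := real_eigenvalues (path_mx M R).

Definition path_energy (R : rcfType) (p : nat) (M : simple_graph p) : R :=
  \sum_(x <- path_eigenvalues R M) `|x|.

Lemma is_path_rev p (M : simple_graph p) i j s :
  is_path M i j s -> is_path M j i (rev s).
Proof.
case: s => [//|x s] /and4P[/eqP xi ps /eqP lj us]; subst x.
have ur : uniq (rev (i :: s)) by rewrite rev_uniq.
have li : last j (rev (belast i s)) = i.
  by case: s lj {ps us ur} => [|y s] //= _; rewrite rev_cons last_rcons.
have pr : path (adj M) j (rev (belast i s)).
  rewrite -lj rev_path; apply: sub_path ps => y z /=; rewrite adj_sym //.
move: ur; rewrite (lastI i s) rev_rcons lj => ur.
by apply/and4P; split; rewrite ?li.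
Qed.

Lemma max_disjoint_paths_sym p (M : simple_graph p) i j :
  max_disjoint_paths M i j = max_disjoint_paths M j i.
Proof.
suff H a b : (max_disjoint_paths M a b <= max_disjoint_paths M b a)%N.
  by apply/eqP; rewrite eqn_leq !H.
apply/bigmax_leqP => F /andP[/forall_inP Fp /forall_inP Fd].
pose f (s : p.-bseq 'I_p) : p.-bseq 'I_p := [bseq of rev s].
have f_inj : injective f.
  by move=> s t /(congr1 val) /= /(can_inj revK) /val_inj.
rewrite -(card_imset _ f_inj); apply: bigop.bigmax_sup (leqnn _).
apply/andP; split.
  by apply/forall_inP=> _ /imsetP[s sF ->]; exact/is_path_rev/Fp.
apply/forall_inP=> _ /imsetP[s sF ->]; apply/forall_inP=> _ /imsetP[t tF ->].
apply/implyP; rewrite (inj_eq f_inj) => st; apply/forallP=> x.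
have /forall_inP/(_ t tF)/implyP/(_ st)/forallP/(_ x) := Fd s sF.
by rewrite !mem_rev [(x == b) || _]orbC.
Qed.

Lemma path_mx_sym (R : pzRingType) p (M : simple_graph p) :
  (path_mx M R)^T = path_mx M R.
Proof.
by apply/matrixP=> i j; rewrite !mxE eq_sym max_disjoint_paths_sym.
Qed.

Lemma real_sym_char_poly_split (R : rcfType) n (A : 'M[R]_n) :
  A^T = A -> exists s : seq R, char_poly A = \prod_(x <- s) ('X - x%:P).
Proof.
move=> At; pose f := real_complex R; pose B := map_mx f A.
have Bh : B \is hermsymmx.
  apply: realsym_hermsym.
    by apply/is_hermitianmxP; rewrite expr0 scale1r map_mx_id // /B map_trmx At.
  by apply/mxOverP=> i j; rewrite mxE; apply/complex_realP; exists (A i j).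
have Bd := hermitian_spectral_diag_real Bh.
have /hermitian_normalmx/orthomx_spectralP := Bh.
set P := spectralmx B; set d := spectral_diag B in Bd * => BE.
have Pu : P \in unitmx by exact: spectral_unit.
have cB : char_poly B = \prod_(i < n) ('X - (d 0 i)%:P).
  have PX : map_mx polyC (invmx P) *m map_mx polyC P = 1%:M.
    by rewrite -map_mxM mulVmx // map_mx1.
  have -> : char_poly B = char_poly (diag_mx d).
    have E : char_poly_mx B =
        map_mx polyC (invmx P) *m char_poly_mx (diag_mx d) *m map_mx polyC P.
      rewrite /char_poly_mx mulmxBr mulmxBl -!map_mxM -BE; congr (_ - _).
      by rewrite mul_mx_scalar -scalemxAl PX scalemx1.
    by rewrite /char_poly E !det_mulmx mulrAC -det_mulmx PX det1 mul1r.
  rewrite char_poly_trig ?diag_mx_is_trig //.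
  by apply: eq_bigr => i _; rewrite mxE eqxx mulr1n.
exists [seq complex.Re (d 0 i) | i <- enum 'I_n].
apply: (map_poly_inj f); rewrite map_char_poly -/B cB.
rewrite rmorph_prod big_map big_enum /=; apply: eq_bigr => i _.
rewrite rmorphB /= map_polyX map_polyC /=; congr (_ - _%:P).
have /mxOverP/(_ 0 i)/complex_realP[k ->] := Bd; by [].
Qed.

Lemma char_poly_real_eigenvalues (R : rcfType) n (A : 'M[R]_n) : A^T = A ->
  char_poly A = \prod_(x <- real_eigenvalues A) ('X - x%:P).
Proof.
move=> /real_sym_char_poly_split[s sE]; rewrite /real_eigenvalues sE.
set q := \prod_(x <- s) _; apply: perm_big; rewrite perm_sym.
have q0 : q != 0 by rewrite monic_neq0 ?monic_prod_XsubC.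
apply/allP=> x _ /=; apply/eqP.
rewrite count_flatten -map_comp sumnE big_map -mu_prod_XsubC -/q.
under eq_bigr do rewrite /= count_nseq mulnbl /=.
have [xq|xNq] := boolP (x \in rootsR q).
  rewrite (big_rem x) //= eqxx big_seq big1 ?addn0 // => y.
  by rewrite (rem_filter _ (uniq_roots _ _ _)) mem_filter /= => /andP[/negPf->].
rewrite big_seq big1 => [|y yq]; last by case: eqP yq xNq => // -> ->.
apply/esym/mupNroot; move: xNq; by rewrite -(roots_on_rootsR q0).
Qed.

Lemma char_poly_path_eigenvalues (R : rcfType) p (M : simple_graph p) :
  char_poly (path_mx M R) =
  \prod_(x <- path_eigenvalues R M) ('X - x%:P).
Proof. exact/char_poly_real_eigenvalues/path_mx_sym. Qed.

(* Main.v *)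
(* A family of disjoint paths from v_i to v_j injects into the neighbours of v_i
   (take the second vertex of each path), so every entry of the path matrix is
   at most Delta and every column sum is at most (p - 1) Delta.  A column sum
   bound is a bound for the eigenvalues, of which there are p because the matrix
   is real symmetric. *)
Require Import Defs.
From mathcomp Require Import all_boot all_order all_algebra.
From mathcomp Require Import reals.

Import Order.TTheory GRing.Theory Num.Theory.
Local Open Scope ring_scope.

(** Injectivity: a second vertex common to two distinct paths of the family is not [i], so
    disjointness makes it [j]; both paths are then the edge path, a contradiction. *)
Lemma max_disjoint_paths_le_degree (p : nat) (M : simple_graph p) (i j : 'I_p) :
  i != j -> (max_disjoint_paths M i j <= degree M i)%N.
Proof.
move=> ij; apply/bigmax_leqP => F /andP[/forall_inP Fp /forall_inP Fd].
(* On [F] the default [i] is never reached: since [i != j], each path has at least two vertices. *)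
pose f (s : p.-bseq 'I_p) := nth i s 1.
have pathE s : s \in F -> exists s', [/\ s = [:: i, f s & s'] :> seq 'I_p,
    adj M i (f s), uniq [:: i, f s & s'] & last (f s) s' = j].
  move=> /Fp; rewrite /f; case: (bseqval s) => [//|x [|y s']] /=.
    by case/and3P=> /eqP-> /eqP xj; rewrite xj eqxx in ij.
  case/and4P=> /eqP-> /andP[iy _] /eqP lj us.
  by exists s'; split.
rewrite -(card_in_imset (f := f)) => [|s t sF tF fst].
  apply/subset_leq_card/subsetP => _ /imsetP[s sF ->].
  by rewrite inE; have [s' []] := pathE s sF.
apply/eqP; apply: contraT => st.
have [s' [sE _ us ls]] := pathE s sF; have [t' [tE _ ut lt]] := pathE t tF.
have /forall_inP/(_ t tF)/implyP/(_ st)/forallP/(_ (f s)) := Fd s sF.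
have fs_in : f s \in (s : seq 'I_p) by rewrite sE !inE eqxx orbT.
have ft_in : f s \in (t : seq 'I_p) by rewrite fst tE !inE eqxx orbT.
rewrite fs_in ft_in /=.
have /negPf-> : f s != i.
  by move: us; rewrite /= inE negb_or eq_sym => /andP[/andP[]].
move=> /eqP fsj.
(* A path whose second vertex is its end [j] is the edge path. *)
have nil_of u : uniq [:: i, j & u] -> last j u = j -> u = [::].
  case: u => [//|y u] /and3P[_ /negP ju _] /= lu.
  by case: ju; rewrite -{1}lu mem_last.
have ftj : f t = j by rewrite -fst.
rewrite fsj in us ls sE; rewrite ftj in ut lt tE.
case/negP: st; apply/eqP/val_inj => /=.
by rewrite sE tE (nil_of s') // (nil_of t').
Qed.

(** The zero diagonal is kept apart so that a column sum has [p - 1] terms instead of [p]. *)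
Lemma path_mx_bounds (R : numDomainType) (p : nat) (M : simple_graph p) i j :
  `|path_mx M R i j| <= (if i == j then 0 else (max_degree M)%:R).
Proof.
rewrite mxE; case: ifPn => ij; first by rewrite normr0.
rewrite normr_nat ler_nat (leq_trans (max_disjoint_paths_le_degree _ _ _ _ ij)) //.
exact: leq_bigmax.
Qed.

(** Eigenvectors here are row vectors, hence column sums: read [v *m A = a *: v] at a coordinate [k]
    where [v 0 k] has the largest absolute value, and cancel that value. *)
Lemma eigenvalue_norm_le (R : realFieldType) (n : nat) (A : 'M[R]_n) (c a : R) :
  (forall j, \sum_i `|A i j| <= c) -> eigenvalue A a -> `|a| <= c.
Proof.
move=> Ac /eigenvalueP[v vA /rV0Pn[i0 vi0]].
have [k _ vk] := @arg_maxP _ _ _ i0 predT (fun i => `|v 0 i|) isT.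
have vk_gt0 : 0 < `|v 0 k| by rewrite (lt_le_trans _ (vk i0 isT)) ?normr_gt0.
have := congr1 (fun w : 'rV_n => `|w 0 k|) vA; rewrite !mxE normrM => vAk.
rewrite -(ler_pM2r vk_gt0) -vAk (le_trans (ler_norm_sum _ _ _)) //.
apply: le_trans (ler_wpM2r (ltW vk_gt0) (Ac k)).
rewrite mulr_suml; apply: ler_sum => i _.
by rewrite normrM mulrC ler_wpM2l //; apply: vk.
Qed.

(** Compare degrees in the factorization of the characteristic polynomial into linear factors. *)
Lemma size_path_eigenvalues (R : rcfType) (p : nat) (M : simple_graph p) :
  size (path_eigenvalues R M) = p.
Proof.
apply: succn_inj.
by rewrite -(size_char_poly (path_mx M R)) char_poly_path_eigenvalues
  size_prod_XsubC.
Qed.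

Lemma path_eigenvalue_le (R : rcfType) (p : nat) (M : simple_graph p) (x : R) :
  x \in path_eigenvalues R M -> `|x| <= (p%:R - 1) * (max_degree M)%:R.
Proof.
move=> xM; have : eigenvalue (path_mx M R) x.
  by rewrite eigenvalue_root_char char_poly_path_eigenvalues root_prod_XsubC.
apply: eigenvalue_norm_le => j.
apply: (le_trans (ler_sum _ (fun i _ => path_mx_bounds R p M i j))).
rewrite (bigD1 j) //= eqxx add0r.
rewrite (eq_bigr (fun=> (max_degree M)%:R)) => [|i /negPf-> //].
rewrite sumr_const cardC1 card_ord -[leLHS]mulr_natl.
(* The count [p.-1] casts to [p%:R - 1] only when [p] is positive; the column index [j] rules out
   [p = 0]. *)
by case: p M xM j => [|q] M xM j; [case: j | rewrite -[q.+1%:R]natr1 addrK].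
Qed.

Theorem corollary2p4 (R : realType) (p : nat) (M : simple_graph p) :
  path_energy R M <= p%:R * (p%:R - 1) * (max_degree M)%:R.
Proof.
rewrite /path_energy big_seq.
apply: (le_trans (ler_sum _ (path_eigenvalue_le R p M))).
by rewrite -big_seq big_const_seq count_predT size_path_eigenvalues iter_addr_0
  -[leLHS]mulr_natl mulrA.
Qed.
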